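(* Let $\{X_\alpha\}$ be a deconcatenation basis, and let $f, g \colon \mathrm{Comp}_{>0} \to \mathbbm{k}$ be nonsingular functions satisfying $X_\alpha = \sum_{\beta \ge \alpha} f(\alpha, \beta) M_\beta$ and $M_\alpha = \sum_{\beta \ge \alpha} g(\alpha, \beta) X_\beta$. Then the following are equivalent: (i) $\{X_\alpha\}$ is a shuffle basis. (ii) $f^\mathrm{Sh}$ is a character of $\mathrm{Sh}$. (iii) $g^\mathrm{QSym}$ is an infinitesimal character of $\mathrm{QSym}$.
   Context: Work over a field $\mathbbm{k}$. A composition is a finite sequence of positive integers; $\mathrm{Comp}_{>0}$ is the set of nonempty compositions. For compositions with $|\alpha|=|\beta|$, $\alpha\le\beta$ means $\alpha=\alpha^{(1)}\cdots\alpha^{(\ell(\beta))}$ (concatenation) with $\alpha^{(i)}$ a composition of $\beta_i$. For $f\colon\mathrm{Comp}_{>0}\to\mathbbm{k}$ and $\alpha\le\beta$, $f(\alpha,\beta)=f(\alpha^{(1)})\cdots f(\alpha^{(\ell(\beta))})$ (with $f(\emptyset,\emptyset)=1$); $f$ is nonsingular if $f(n)\ne0$ for all positive integers $n$. $\{M_\alpha\}$ is the monomial basis of the Hopf algebra $\mathrm{QSym}$ of quasisymmetric functions. A deconcatenation basis of $\mathrm{QSym}$ is a graded basis $\{D_\alpha\}$ with $\Delta(D_\gamma)=\sum_{\alpha\beta=\gamma}D_\alpha\otimes D_\beta$. For compositions $\alpha,\beta$, $\alpha \sqcup\!\sqcup \beta$ denotes the multiset of all compositions of length $\ell(\alpha)+\ell(\beta)$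 containing $\alpha,\beta$ as disjoint subsequences, with multiplicity. A shuffle basis is a deconcatenation basis $\{X_\alpha\}$ which also satisfies $X_\alpha X_\beta=\sum_{\gamma\in\alpha \sqcup\!\sqcup \beta}X_\gamma$. The shuffle algebra $\mathrm{Sh}$ has basis $\{x_\alpha\}$ over compositions with product $x_\alpha x_\beta=\sum_{\gamma\in\alpha \sqcup\!\sqcup \beta}x_\gamma$ and deconcatenation coproduct. $f^\mathrm{Sh}\colon\mathrm{Sh}\to\mathbbm{k}$ is the linear map with $f^\mathrm{Sh}(x_\emptyset)=1$, $f^\mathrm{Sh}(x_\alpha)=f(\alpha)$ for $\alpha\ne\emptyset$; $g^\mathrm{QSym}\colon\mathrm{QSym}\to\mathbbm{k}$ is linear with $g^\mathrm{QSym}(M_\emptyset)=0$, $g^\mathrm{QSym}(M_\alpha)=g(\alpha)$ for $\alpha\ne\emptyset$. A character is an algebra map to $\mathbbm{k}$; an infinitesimal character is a linear $\xi$ with $\xi(ab)=\varepsilon(a)\xi(b)+\xi(a)\varepsilon(b)$. *)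

(* Defs.v *)
From HB Require Import structures.
From mathcomp Require Import all_boot all_algebra.
From mathcomp Require Import finmap monalg zify.

Set Implicit Arguments.
Unset Strict Implicit.
Unset Printing Implicit Defensive.

Import GRing.Theory.
Local Open Scope ring_scope.

Notation part := {n : nat | (0 < n)%N}.
Notation Comp := (seq part).

Definition wt (a : Comp) : nat := sumn (map val a).

Fact part_add_subproof (i j : part) : (0 < val i + val j)%N.
Proof. by rewrite addn_gt0 (valP i). Qed.
Definition part_add (i j : part) : part :=
  Sub (val i + val j)%N (part_add_subproof i j).

Lemma part_addC i j : part_add i j = part_add j i.
Proof. by apply: val_inj; rewrite /= addnC. Qed.
Lemma part_addA i j l :
  part_add (part_add i j) l = part_add i (part_add j l).
Proof. by apply: val_inj; rewrite /= addnA. Qed.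

Lemma wt_cons x (a : Comp) : wt (x :: a) = (val x + wt a)%N.
Proof. by []. Qed.

(* The shortest prefix of [a] of weight at least [n], and what follows it. *)
Fixpoint take_wt (n : nat) (a : Comp) : Comp :=
  if a is x :: a' then
    if n == 0%N then [::] else x :: take_wt (n - val x) a'
  else [::].
Fixpoint drop_wt (n : nat) (a : Comp) : Comp :=
  if a is x :: a' then if n == 0%N then a else drop_wt (n - val x) a'
  else [::].

(* When a <= b, this is [a^(1); ...; a^(l(b))]; see [comp_leP], [blocksE]. *)
Fixpoint blocks (a b : Comp) : seq Comp :=
  if b is y :: b' then take_wt (val y) a :: blocks (drop_wt (val y) a) b'
  else [::].

Definition comp_le (a b : Comp) : bool :=
  (a == flatten (blocks a b)) && (map wt (blocks a b) == map val b).

Lemma take_wt_cat c r : take_wt (wt c) (c ++ r) = c.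
Proof.
elim: c => [|x c IH] /=; first by case: r.
rewrite wt_cons addn_eq0 addKn IH.
by have := valP x; rewrite lt0n => /negPf->.
Qed.
Lemma drop_wt_cat c r : drop_wt (wt c) (c ++ r) = r.
Proof.
elim: c => [|x c IH] /=; first by case: r.
rewrite wt_cons addn_eq0 addKn IH.
by have := valP x; rewrite lt0n => /negPf->.
Qed.

Lemma blocksE (b : Comp) (B : seq Comp) :
  map wt B = map val b -> blocks (flatten B) b = B.
Proof.
elim: b B => [|y b IH] [|c B] //= [wc wB].
by rewrite -wc take_wt_cat drop_wt_cat IH.
Qed.

Lemma comp_leP (a b : Comp) :
  reflect (exists B : seq Comp, a = flatten B /\ map wt B = map val b)
          (comp_le a b).
Proof.
apply: (iffP andP) => [[/eqP ha /eqP hb]|[B [-> wB]]].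
  by exists (blocks a b).
by rewrite (blocksE wB) wB !eqxx.
Qed.

(* f(a, b), meaningful for a <= b.  A function on nonempty compositions is
   represented by a function on [Comp] whose value at [::] is never used
   (every block of a <= b is nonempty). *)
Definition fpair (k : comNzRingType) (f : Comp -> k) (a b : Comp) : k :=
  \prod_(c <- blocks a b) f c.

Definition nonsingular (k : comNzRingType) (f : Comp -> k) : Prop :=
  forall n : part, f [:: n] != 0.

Definition merge_head (x : part) (b : Comp) : option Comp :=
  if b is y :: b' then Some (part_add x y :: b') else None.

(* The compositions b such that a <= b, each listed once; see
   [mem_coarsenings] and [uniq_coarsenings]. *)
Fixpoint coarsenings (a : Comp) : seq Comp :=
  if a is x :: a' then
    map (cons x) (coarsenings a') ++ pmap (merge_head x) (coarsenings a')
  else [:: [::]].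

Lemma mem_coarsenings a b : (b \in coarsenings a) = comp_le a b.
Proof.
apply/idP/comp_leP => [|[B []]].
  elim: a b => [|x a IH] b /=; first by rewrite inE => /eqP->; exists [::].
  rewrite mem_cat => /orP[/mapP[b' /IH[B [-> wB]] ->]|].
    by exists ([:: x] :: B); rewrite /= wB /wt /= addn0.
  rewrite mem_pmap => /mapP[[|y b'] /IH[[|c B] [-> wB]]] //= [->].
  by case: wB => wc wB; exists ((x :: c) :: B); rewrite /= wB wt_cons wc.
elim: a b B => [|x a IH] b B.
  case: B b => [|c B] [|y b] //= + [].
  by case: c => // _; have := valP y; rewrite /wt /= => + e; rewrite -e.
case: B b => [|c B] [|y b] //=; case: c => [|z c] /=.
  by move=> _ []; have := valP y; rewrite /wt /= => + e; rewrite -e.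
case=> <- + []; rewrite mem_cat wt_cons; case: c => [|z' c] ha wy wB.
  have -> : y = x by apply: val_inj; rewrite -[val x]addn0; exact: esym wy.
  by rewrite map_f //; apply: (IH b B).
have wc0 : (0 < wt (z' :: c))%N by rewrite wt_cons addn_gt0 (valP z').
apply/orP; right; rewrite mem_pmap.
apply/mapP; exists ((Sub _ wc0 : part) :: b).
  by apply: (IH _ ((z' :: c) :: B)) => //=; congr (_ :: _).
by congr (Some (_ :: _)); apply: val_inj; exact: esym wy.
Qed.

Lemma uniq_coarsenings a : uniq (coarsenings a).
Proof.
elim: a => [|x a IH] //=; rewrite cat_uniq map_inj_uniq ?IH; last by move=> ? ? [].
rewrite andTb; apply/andP; split.
  apply/hasPn => b; rewrite mem_pmap => /mapP[[|y b'] _] // [->].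
  apply/negP => /mapP[b'' _ [/(congr1 val) e _]].
  have {}e : (val x + val y = val x)%N := e.
  by have := valP y; lia.
have E s : pmap (merge_head x) s =
   map (fun b => if b is y :: b' then part_add x y :: b' else [::])
       (filter (fun b : Comp => b != [::]) s).
  by elim: s => [|[|y b] s IHs] //=; rewrite IHs.
rewrite E map_inj_in_uniq ?filter_uniq //.
move=> [|y b] [|z c]; rewrite !mem_filter //= => _ _ [/addnI e ->].
by congr (_ :: _); apply: val_inj.
Qed.

(* [m x y] lists the letters into which x and y may merge. *)
Section Stuffle.
Variables (T : Type) (m : T -> T -> seq T).

Fixpoint stuffle (a : seq T) : seq T -> seq (seq T) :=
  if a is x :: a' then
    fix stuffle_a (b : seq T) : seq (seq T) :=
      if b is y :: b' then
        map (cons x) (stuffle a' b) ++ map (cons y) (stuffle_a b')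
        ++ [seq z :: c | z <- m x y, c <- stuffle a' b']
      else [:: a]
  else fun b => [:: b].

Lemma stuffle0s b : stuffle [::] b = [:: b]. Proof. by []. Qed.
Lemma stuffles0 a : stuffle a [::] = [:: a]. Proof. by case: a. Qed.
Lemma stuffle_cons x a y b : stuffle (x :: a) (y :: b) =
  map (cons x) (stuffle a (y :: b)) ++ map (cons y) (stuffle (x :: a) b)
  ++ [seq z :: c | z <- m x y, c <- stuffle a b].
Proof. by []. Qed.

Variable V : nmodType.
Implicit Type h : seq T -> V.

Lemma sum_stuffle_cons h x a y b :
  \sum_(c <- stuffle (x :: a) (y :: b)) h c =
  \sum_(c <- stuffle a (y :: b)) h (x :: c)
  + \sum_(c <- stuffle (x :: a) b) h (y :: c)
  + \sum_(z <- m x y) \sum_(c <- stuffle a b) h (z :: c).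
Proof. by rewrite stuffle_cons !big_cat !big_map big_allpairs_dep /= addrA. Qed.

Hypothesis mC : forall x y, m x y = m y x.
Hypothesis mA : forall x y z,
  [seq w | t <- m x y, w <- m t z] = [seq w | t <- m y z, w <- m x t].

Lemma sum_stuffleC h a b :
  \sum_(c <- stuffle a b) h c = \sum_(c <- stuffle b a) h c.
Proof.
have [n] := ubnP (size a + size b); elim: n a b h => // n IH.
move=> [|x a] [|y b] h le //; rewrite !sum_stuffle_cons.
move: le => /= le.
rewrite (IH a (y :: b)) ?(IH (x :: a) b) /=; try lia.
rewrite mC [X in X + _ = _]addrC; congr (_ + _).
by apply: eq_bigr => z _; apply: IH; lia.
Qed.

Definition sum3 h a b c :=
  \sum_(d <- stuffle a b) \sum_(e <- stuffle d c) h e.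

Lemma sum3_cons h x a y b z c :
  sum3 h (x :: a) (y :: b) (z :: c) =
    sum3 (fun e => h (x :: e)) a (y :: b) (z :: c)
  + sum3 (fun e => h (y :: e)) (x :: a) b (z :: c)
  + sum3 (fun e => h (z :: e)) (x :: a) (y :: b) c
  + (\sum_(t <- m x y) sum3 (fun e => h (t :: e)) a b (z :: c)
     + \sum_(t <- m x z) sum3 (fun e => h (t :: e)) a (y :: b) c
     + \sum_(t <- m y z) sum3 (fun e => h (t :: e)) (x :: a) b c)
  + \sum_(t <- [seq w | t <- m x y, w <- m t z])
       sum3 (fun e => h (t :: e)) a b c.
Proof.
rewrite {1}/sum3 sum_stuffle_cons.
under eq_bigr do rewrite sum_stuffle_cons.
under [X in _ + X + _]eq_bigr do rewrite sum_stuffle_cons.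
under [X in _ + _ + X]eq_bigr do
  (under eq_bigr do rewrite sum_stuffle_cons; rewrite !big_split /=).
rewrite !big_split /=.
rewrite [X in _ + _ + X + _ + _ = _]exchange_big.
rewrite [X in _ + (_ + _ + X) + _ = _]exchange_big.
under [X in _ + _ + (_ + _ + X) = _]eq_bigr do rewrite exchange_big.
rewrite [X in _ = _ + _ + X + _ + _]/sum3 sum_stuffle_cons big_allpairs_dep.
have ac (P S1 U1 Q S2 U2 U3 S3 W : V) :
    P + S1 + U1 + (Q + S2 + U2) + (U3 + S3 + W)
    = P + Q + (S1 + S2 + S3) + (U3 + U1 + U2) + W.
  by rewrite !addrA [LHS](ACl (1*4*2*5*8*7*3*6*9)).
exact: ac.
Qed.

Lemma sum3_rev h a b c : sum3 h a b c = sum3 h c b a.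
Proof.
have [n] := ubnP (size a + size b + size c); elim: n a b c h => // n IH.
have r0 b1 h1 : \sum_(d <- b1) \sum_(e <- stuffle d [::]) h1 e = \sum_(d <- b1) h1 d.
  by apply: eq_bigr => d _; rewrite stuffles0 big_seq1.
move=> [|x a] [|y b] [|z c] h le;
  rewrite /sum3 ?stuffle0s ?stuffles0 ?big_seq1 //.
- by rewrite [RHS]r0; exact: sum_stuffleC.
- exact: sum_stuffleC.
- by rewrite [LHS]r0; exact: sum_stuffleC.
rewrite -!/(sum3 _ _ _ _) !sum3_cons; move: le => /= le.
have E : [seq w | t <- m z y, w <- m t x] = [seq w | t <- m x y, w <- m t z].
  by rewrite mA mC; congr flatten; apply: eq_map => t; rewrite mC.
rewrite E (mC z y) (mC z x) (mC y x).
rewrite [RHS](AC (3*3*1) (3*2*1*(6*5*4)*7)).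
congr (_ + _ + _ + (_ + _ + _) + _); try (by apply: IH => /=; lia);
  by apply: eq_bigr => t _; apply: IH => /=; lia.
Qed.

Lemma sum_stuffleA h a b c :
  \sum_(d <- stuffle a b) \sum_(e <- stuffle d c) h e =
  \sum_(d <- stuffle b c) \sum_(e <- stuffle a d) h e.
Proof.
rewrite -/(sum3 h a b c) sum3_rev /sum3 sum_stuffleC.
by apply: eq_bigr => d _; exact: sum_stuffleC.
Qed.
End Stuffle.

Arguments stuffle : simpl never.

Section Lift.
Variables (R : comNzRingType) (I : choiceType) (V : lmodType R).

(* The linear map sending the basis vector [<< i >>] to [h i]. *)
Definition lift (h : I -> V) (p : {malg R[I]}) : V :=
  \sum_(i <- msupp p) p@_i *: h i.

Lemma liftEw (d : {fset I}) h p : (msupp p `<=` d)%fset ->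
  lift h p = \sum_(i <- d) p@_i *: h i.
Proof.
move=> le; rewrite /lift (big_fset_incl _ le) // => i _ /mcoeff_outdom ->.
by rewrite scale0r.
Qed.

Fact lift_is_linear h : linear (lift h).
Proof.
move=> c p q; set d := (msupp (c *: p + q) `|` msupp p `|` msupp q)%fset.
have s1 : (msupp (c *: p + q) `<=` d)%fset by rewrite /d -fsetUA fsubsetUl.
have s2 : (msupp p `<=` d)%fset by rewrite /d -fsetUA fsetUCA fsubsetUl.
have s3 : (msupp q `<=` d)%fset by rewrite fsubsetUr.
rewrite (liftEw h s1) (liftEw h s2) (liftEw h s3) scaler_sumr -big_split /=.
by apply: eq_bigr => i _; rewrite mcoeffD mcoeffZ scalerDl scalerA.
Qed.
HB.instance Definition _ h :=
  GRing.isLinear.Build R {malg R[I]} V *:%R (lift h) (lift_is_linear h).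

Lemma liftU h i : lift h << i >> = h i.
Proof.
by rewrite /lift msuppU oner_eq0 big_seq_fset1 mcoeffUU scale1r.
Qed.

Lemma lin_ext (f g : {linear {malg R[I]} -> V}) :
  (forall i, f << i >> = g << i >>) -> f =1 g.
Proof.
have U (c : R) i : << c *g i >> = c *: << i >> :> {malg R[I]}.
  by apply/malgP => j; rewrite mcoeffZ !mcoeffU mulrnAr mulr1.
move=> e p; rewrite (monalgE p) !linear_sum; apply: eq_bigr => i _.
by rewrite U !linearZ_LR e.
Qed.

(* [D] is a basis of [V]: every vector is a unique finite linear combination
   of the [D i]. *)
Definition is_basis (D : I -> V) : Prop :=
  forall v : V, exists! c : {malg R[I]}, v = lift D c.
End Lift.

Section StuffleProduct.
Variables (R : comNzRingType) (T : choiceType) (m : T -> T -> seq T).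
Implicit Types p q r : {malg R[seq T]}.

(* The bilinear product with [<< a >> * << b >>] the sum of [stuffle m a b]. *)
Definition stuffle_mul p q : {malg R[seq T]} :=
  lift (fun a => lift (fun b => \sum_(c <- stuffle m a b) << c >>) q) p.

Local Notation "p *s q" := (stuffle_mul p q) (at level 40).

Lemma stuffle_mulUU a b :
  << a >> *s << b >> = \sum_(c <- stuffle m a b) << c >>.
Proof. by rewrite /stuffle_mul !liftU. Qed.

Lemma stuffle_mulPl q c p1 p2 : (c *: p1 + p2) *s q = c *: (p1 *s q) + p2 *s q.
Proof. exact: linearP. Qed.

Lemma stuffle_mulPr p c q1 q2 : p *s (c *: q1 + q2) = c *: (p *s q1) + p *s q2.
Proof.
rewrite /stuffle_mul /lift scaler_sumr -big_split; apply: eq_bigr => a _ /=.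
by rewrite -/(lift _ _) linearP scalerDr !scalerA mulrC.
Qed.

Lemma lin_ext_prop (V : lmodType R) (I : choiceType) (f g : {malg R[I]} -> V) :
  linear f -> linear g -> (forall i, f << i >> = g << i >>) -> f =1 g.
Proof.
move=> lf lg.
pose F := GRing.isLinear.Build R {malg R[I]} V *:%R f lf.
pose G := GRing.isLinear.Build R {malg R[I]} V *:%R g lg.
pose f' : {linear _ -> _} := HB.pack f F.
pose g' : {linear _ -> _} := HB.pack g G.
exact: (@lin_ext R I V f' g').
Qed.

Lemma scalar_ext (I : choiceType) (f g : {malg R[I]} -> R) :
  scalar f -> scalar g -> (forall i, f << i >> = g << i >>) -> f =1 g.
Proof. exact: (@lin_ext_prop R^o). Qed.

Hypothesis mC : forall x y, m x y = m y x.
Hypothesis mA : forall x y z,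
  [seq w | t <- m x y, w <- m t z] = [seq w | t <- m y z, w <- m x t].

Lemma stuffle_mulC : commutative stuffle_mul.
Proof.
move=> p q; move: p; apply: lin_ext_prop => [c x y|c x y|a].
- exact: stuffle_mulPl.
- exact: stuffle_mulPr.
move: q; apply: lin_ext_prop => [c x y|c x y|b].
- exact: stuffle_mulPr.
- exact: stuffle_mulPl.
by rewrite !stuffle_mulUU sum_stuffleC.
Qed.

Lemma stuffle_mulA : associative stuffle_mul.
Proof.
move=> p q r; move: p; apply: lin_ext_prop => [c x y|c x y|a].
- by rewrite stuffle_mulPl.
- by rewrite !stuffle_mulPl.
move: q; apply: lin_ext_prop => [c x y|c x y|b].
- by rewrite stuffle_mulPl stuffle_mulPr.
- by rewrite stuffle_mulPr stuffle_mulPl.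
move: r; apply: lin_ext_prop => [c x y|c x y|c].
- by rewrite !stuffle_mulPr.
- by rewrite stuffle_mulPr.
rewrite !stuffle_mulUU [RHS]linear_sum /stuffle_mul liftU linear_sum /=.
under eq_bigr do rewrite liftU.
under [RHS]eq_bigr do rewrite !liftU.
by rewrite sum_stuffleA.
Qed.

Lemma stuffle_mul1 : left_id << [::] >> stuffle_mul.
Proof.
apply: lin_ext_prop => [c x y|c x y|b]; rewrite ?stuffle_mulPr //.
by rewrite stuffle_mulUU stuffle0s big_seq1.
Qed.

Lemma stuffle_mulDl : left_distributive stuffle_mul +%R.
Proof. by move=> p1 p2 q; rewrite -[p1]scale1r stuffle_mulPl !scale1r. Qed.

Lemma stuffle_mulAl c p q : c *: (p *s q) = (c *: p) *s q.
Proof. by rewrite /stuffle_mul linearZ_LR. Qed.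

Lemma stuffle_one_neq0 : << [::] >> != 0 :> {malg R[seq T]}.
Proof. by rewrite monalgU_eq0 oner_eq0. Qed.
End StuffleProduct.

Definition shuffle (T : Type) : seq T -> seq T -> seq (seq T) :=
  stuffle (fun _ _ => [::]).

Definition quasi_shuffle : Comp -> Comp -> seq Comp :=
  stuffle (fun i j => [:: part_add i j]).

Fixpoint bitseqs (n : nat) : seq bitseq :=
  if n is n'.+1 then map (cons true) (bitseqs n') ++ map (cons false) (bitseqs n')
  else [:: [::]].

(* The multiplicity of c in [shuffle a b] is the number of ways of splitting
   the positions of c into two classes spelling a and b. *)
Lemma count_shuffle (T : eqType) (a b c : seq T) :
  count_mem c (shuffle a b) =
  count (fun s => (mask s c == a) && (mask (map negb s) c == b))
        (bitseqs (size c)).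
Proof.
have S x a' y b' : shuffle (x :: a') (y :: b') =
    map (cons x) (shuffle a' (y :: b')) ++ map (cons y) (shuffle (x :: a') b').
  by rewrite /shuffle stuffle_cons /= cats0.
have C x z c' (s : seq (seq T)) :
    count_mem (z :: c') (map (cons x) s) = ((x == z) * count_mem c' s)%N.
  by rewrite count_map; elim: s => [|t s IHs] /=; rewrite ?muln0 // IHs eqseq_cons;
    case: eqP; rewrite ?mul0n ?mul1n.
elim: c a b => [|z c IH] a b.
  case: a b => [|x a] [|y b] //; rewrite S count_cat !count_map /=.
  by rewrite !(eq_count (a2 := pred0)) ?count_pred0 //.
rewrite /= count_cat !count_map.
have E x (P : bitseq -> bool) (Q : pred bitseq) s :
    (forall t, P t = (x : bool) && Q t) -> count P s = (x * count Q s)%N.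
  move=> PQ; rewrite (eq_count PQ); case: x {PQ}; rewrite ?mul1n //= mul0n.
  exact: count_pred0.
have E0 (P : pred bitseq) s : (forall t, P t = false) -> count P s = 0%N.
  by move=> P0; rewrite (eq_count P0) count_pred0.
case: a b => [|x a] [|y b].
- by rewrite !E0 // => t /=; rewrite andbC.
- rewrite E0 // /shuffle stuffle0s.
  rewrite (E (z == y) _ (fun s => (mask s c == [::]) && (mask (map negb s) c == b))).
    by rewrite -IH /shuffle stuffle0s /= eqseq_cons [y == z]eq_sym; case: (z == y) (_ == c) => [] [].
  by move=> t /=; rewrite eqseq_cons andbCA.
- rewrite [X in (_ + X)%N]E0; last by move=> t /=; rewrite andbC.
  rewrite (E (z == x) _ (fun s => (mask s c == a) && (mask (map negb s) c == [::]))).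
    by rewrite -IH /shuffle !stuffles0 /= eqseq_cons [x == z]eq_sym; case: (z == x) (_ == c) => [] [].
  by move=> t /=; rewrite eqseq_cons andbA.
rewrite S count_cat !C !IH eq_sym [y == z]eq_sym; congr (_ + _)%N; apply/esym/E => t /=.
  by rewrite eqseq_cons andbA.
by rewrite eqseq_cons andbCA.
Qed.

Definition sh (k : comNzRingType) : Type := {malg k[Comp]}.

Section ShAlgebra.
Variable k : comNzRingType.

Definition shX (a : Comp) : sh k := << a >>.

HB.instance Definition _ := GRing.Lmodule.on (sh k).

Definition sh_mul : sh k -> sh k -> sh k := stuffle_mul (fun _ _ => [::]).

Fact sh_mulA : associative sh_mul. Proof. exact: stuffle_mulA. Qed.
Fact sh_mulC : commutative sh_mul. Proof. exact: stuffle_mulC. Qed.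
Fact sh_mul1 : left_id (shX [::]) sh_mul. Proof. exact: stuffle_mul1. Qed.
Fact sh_mulDl : left_distributive sh_mul +%R.
Proof. exact: stuffle_mulDl. Qed.
Fact sh_one_neq0 : shX [::] != 0. Proof. exact: stuffle_one_neq0. Qed.
Fact sh_mulAl (c : k) (p q : sh k) : c *: sh_mul p q = sh_mul (c *: p) q.
Proof. exact: stuffle_mulAl. Qed.

HB.instance Definition _ := GRing.Zmodule_isComNzRing.Build (sh k)
  sh_mulA sh_mulC sh_mul1 sh_mulDl sh_one_neq0.
HB.instance Definition _ := GRing.Lmodule_isLalgebra.Build k (sh k) sh_mulAl.
HB.instance Definition _ := GRing.Lalgebra_isComAlgebra.Build k (sh k).

Lemma shXM a b : shX a * shX b = \sum_(c <- shuffle a b) shX c.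
Proof. exact: stuffle_mulUU. Qed.
End ShAlgebra.

(* [p : qsym k] stands for the quasisymmetric series of bounded degree in
   x_1, x_2, ... whose coefficient at x_1^u_1 ... x_n^u_n is [p@_(flat u)],
   so that [qM a] is the monomial quasisymmetric function M_a.  Lemma
   [mcoeff_qsymM] says that the product is the product of power series, and
   [mcoeff_coprod] that the coproduct is F |-> F(x_1, x_2, ..., y_1, y_2, ...). *)
Definition qsym (k : comNzRingType) : Type := {malg k[Comp]}.

Section QSymAlgebra.
Variable k : comNzRingType.

Definition qM (a : Comp) : qsym k := << a >>.

HB.instance Definition _ := GRing.Lmodule.on (qsym k).

Definition qsym_mul : qsym k -> qsym k -> qsym k :=
  stuffle_mul (fun i j => [:: part_add i j]).

Let mC (i j : part) : [:: part_add i j] = [:: part_add j i].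
Proof. by rewrite part_addC. Qed.
Let mA (i j l : part) :
  [seq w | t <- [:: part_add i j], w <- [:: part_add t l]] =
  [seq w | t <- [:: part_add j l], w <- [:: part_add i t]].
Proof. by rewrite /= part_addA. Qed.

Fact qsym_mulA : associative qsym_mul. Proof. exact: stuffle_mulA mA. Qed.
Fact qsym_mulC : commutative qsym_mul. Proof. exact: stuffle_mulC mC. Qed.
Fact qsym_mul1 : left_id (qM [::]) qsym_mul. Proof. exact: stuffle_mul1. Qed.
Fact qsym_mulDl : left_distributive qsym_mul +%R.
Proof. exact: stuffle_mulDl. Qed.
Fact qsym_one_neq0 : qM [::] != 0. Proof. exact: stuffle_one_neq0. Qed.
Fact qsym_mulAl (c : k) (p q : qsym k) :
  c *: qsym_mul p q = qsym_mul (c *: p) q.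
Proof. exact: stuffle_mulAl. Qed.

HB.instance Definition _ := GRing.Zmodule_isComNzRing.Build (qsym k)
  qsym_mulA qsym_mulC qsym_mul1 qsym_mulDl qsym_one_neq0.
HB.instance Definition _ :=
  GRing.Lmodule_isLalgebra.Build k (qsym k) qsym_mulAl.
HB.instance Definition _ := GRing.Lalgebra_isComAlgebra.Build k (qsym k).

Lemma qMM a b : qM a * qM b = \sum_(c <- quasi_shuffle a b) qM c.
Proof. exact: stuffle_mulUU. Qed.

Definition counit (p : qsym k) : k := p@_[::].

(* The tensor square of [qsym k], with basis [<< (a, b) >>] standing for
   qM a (x) qM b. *)
Definition qsym2 : Type := {malg k[(Comp * Comp)%type]}.
HB.instance Definition _ := GRing.Lmodule.on qsym2.

Definition tens (p q : qsym k) : qsym2 :=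
  lift (fun a => lift (fun b => << (a, b) >> : qsym2) q) p.

Definition coprod : qsym k -> qsym2 :=
  lift (fun c : Comp => \sum_(i < (size c).+1) << (take i c, drop i c) >>).

Definition homogeneous (n : nat) (p : qsym k) : Prop :=
  forall a : Comp, a \in msupp p -> wt a = n.

Definition deconcatenation_basis (D : Comp -> qsym k) : Prop :=
  [/\ is_basis D,
      forall a, homogeneous (wt a) (D a)
    & forall c, coprod (D c) =
        \sum_(i < (size c).+1) tens (D (take i c)) (D (drop i c))].

Definition shuffle_basis (X : Comp -> qsym k) : Prop :=
  deconcatenation_basis X /\
  forall a b, X a * X b = \sum_(c <- shuffle a b) X c.

Lemma mcoeff_tens p q a b : (tens p q)@_(a, b) = p@_a * q@_b.
Proof.
have S (I : choiceType) (V : lmodType k) (h : I -> V) (r : {malg k[I]})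
    (f : V -> k) : scalar f -> f (lift h r) = \sum_(i <- msupp r) r@_i * f (h i).
  move=> lf; pose F := GRing.isLinear.Build k V k *%R f lf.
  pose f' : {scalar V} := HB.pack f F.
  rewrite -[f]/(f' : V -> k) linear_sum; apply: eq_bigr => i _.
  exact: linearZ.
have lc (I : choiceType) (i : I) : scalar (fun r : {malg k[I]} => r@_i).
  by move=> c x y /=; rewrite mcoeffD mcoeffZ.
have D (I : choiceType) (r : {malg k[I]}) i :
    \sum_(j <- msupp r) r@_j * (j == i)%:R = r@_i.
  rewrite [in RHS](monalgE r) raddf_sum; apply: eq_bigr => j _ /=.
  by rewrite mcoeffU mulr_natr.
rewrite (S _ _ _ _ _ (lc _ (a, b))) /=.
under eq_bigr do rewrite (S _ _ _ _ _ (lc _ (a, b))) /=.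
rewrite -(D _ p a) mulr_suml; apply: eq_bigr => a' _.
rewrite -mulrA -(D _ q b) mulr_sumr; congr (_ * _); apply: eq_bigr => b' _.
by rewrite mcoeffU xpair_eqE mulrCA -natrM mulnb.
Qed.

Lemma mcoeff_coprod p a b : (coprod p)@_(a, b) = p@_(a ++ b).
Proof.
move: p; apply: scalar_ext => [c x y|c x y|c] /=.
- by rewrite /coprod linearP mcoeffD mcoeffZ.
- by rewrite mcoeffD mcoeffZ.
rewrite /coprod liftU raddf_sum mcoeffU /=.
under eq_bigr do rewrite mcoeffU xpair_eqE.
have [->|ne] := eqVneq c (a ++ b).
  have lt : (size a < (size (a ++ b)).+1)%N by rewrite size_cat ltnS leq_addr.
  rewrite (bigD1 (Ordinal lt)) //= take_size_cat // drop_size_cat // !eqxx.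
  rewrite big1 ?addr0 // => i ne; case: eqP => // e; case/eqP: ne.
  apply: val_inj; move/(congr1 size): e.
  by rewrite size_takel // -ltnS ltn_ord.
rewrite big1 // => i _; case: eqP => //= ea; case: eqP => //= eb.
by case/eqP: ne; rewrite -ea -eb cat_take_drop.
Qed.
End QSymAlgebra.

Definition flat (u : seq nat) : Comp := pmap insub u.
Arguments flat : simpl never.

(* All (v, w) with u = v + w componentwise. *)
Fixpoint splits (u : seq nat) : seq (seq nat * seq nat) :=
  if u is n :: u' then
    [seq (i :: vw.1, (n - i)%N :: vw.2) | i <- iota 0 n.+1, vw <- splits u']
  else [:: ([::], [::])].

Lemma mcoeff_qsymM (k : comNzRingType) (p q : qsym k) (u : seq nat) :
  (p * q)@_(flat u) =
  \sum_(vw <- splits u) p@_(flat vw.1) * q@_(flat vw.2).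
Proof.
have flat0 u' : flat (0%N :: u') = flat u' by rewrite /flat /= insubF.
have flatS n u' : flat (n.+1 :: u') = (Sub n.+1 (ltn0Sn n) : part) :: flat u'.
  by rewrite /flat /= (insubT (leq 1) (ltn0Sn n)).
have flat_cons i v (a : Comp) : (flat (i :: v) == a) =
    if i is 0%N then flat v == a
    else if a is x :: a' then (val x == i) && (flat v == a') else false.
  case: i => [|i]; first by rewrite flat0.
  by rewrite flatS; case: a => [|x a'] //; rewrite eqseq_cons -val_eqE eq_sym.
pose N (a b : Comp) u' : k := \sum_(vw <- splits u')
  ((flat vw.1 == a) && (flat vw.2 == b))%:R.
have NS (a b : Comp) n u' : N a b (n :: u') = \sum_(i <- iota 0 n.+1)
   \sum_(vw <- splits u') ((flat (i :: vw.1) == a)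
      && (flat ((n - i)%N :: vw.2) == b))%:R.
  rewrite /N -[splits (n :: u')]/[seq (i :: vw.1, (n - i)%N :: vw.2)
    | i <- iota 0 n.+1, vw <- splits u'].
  by rewrite big_allpairs_dep.
suff main (a b : Comp) u' :
    \sum_(c <- quasi_shuffle a b) (c == flat u')%:R = N a b u'.
  move: p; apply: (@scalar_ext k _ (fun p : qsym k => (p * q)@_(flat u))
    (fun p => \sum_(vw <- splits u) p@_(flat vw.1) * q@_(flat vw.2))) => [c x y|c x y|a] /=.
  - by rewrite mulrDl -scalerAl mcoeffD mcoeffZ.
  - rewrite big_distrr -big_split; apply: eq_bigr => i _ /=.
    by rewrite mcoeffD mcoeffZ mulrDl mulrA.
  move: q; apply: (@scalar_ext k _ (fun q => (qM k a * q)@_(flat u))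
    (fun q => \sum_(vw <- splits u) << a >>@_(flat vw.1) * q@_(flat vw.2)))
    => [c x y|c x y|b] /=.
  - by rewrite mulrDr -scalerAr mcoeffD mcoeffZ.
  - rewrite big_distrr -big_split; apply: eq_bigr => i _ /=.
    by rewrite mcoeffD mcoeffZ mulrDr mulrCA.
  rewrite [_ * _]qMM raddf_sum /=.
  under eq_bigr do rewrite mcoeffU.
  rewrite main /N; apply: eq_bigr => vw _.
  by rewrite !mcoeffU -natrM mulnb ![flat _ == _]eq_sym.
elim: u' a b => [|n u' IH] a b.
  rewrite /N /= big_seq1 /=; case: a b => [|x a] [|y b] /=;
    rewrite ?stuffle0s ?stuffles0 ?big_seq1 // sum_stuffle_cons /=.
  by rewrite !big1 ?addr0 // => ? _; rewrite big1.
rewrite NS; case: n => [|n].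
  rewrite big_seq1 flat0 IH; apply: eq_bigr => vw _.
  by rewrite !flat_cons.
rewrite -[iota 0 n.+2]/(index_iota 0 n.+2) big_nat_recl // big_nat_recr //.
have W (C : bool) (P : seq nat * seq nat -> bool) :
    \sum_(vw <- splits u') (C && P vw)%:R = C%:R * \sum_(vw <- splits u') (P vw)%:R :> k.
  by rewrite big_distrr; apply: eq_bigr => vw _ /=; rewrite -natrM mulnb.
have E0 : \sum_(vw <- splits u') ((flat (0%N :: vw.1) == a)
      && (flat ((n.+1 - 0)%N :: vw.2) == b))%:R
    = if b is y :: b' then (val y == n.+1)%:R * N a b' u' else 0 :> k.
  case: b => [|y b]; first by rewrite big1 // => vw _; rewrite !flat_cons andbF.
  by rewrite /N -W; apply: eq_bigr => vw _; rewrite !flat_cons subn0 andbCA.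
have E1 : \sum_(vw <- splits u') ((flat (n.+1 :: vw.1) == a)
      && (flat ((n.+1 - n.+1)%N :: vw.2) == b))%:R
    = if a is x :: a' then (val x == n.+1)%:R * N a' b u' else 0 :> k.
  case: a {E0} => [|x a]; first by rewrite big1 // => vw _; rewrite !flat_cons.
  by rewrite /N -W; apply: eq_bigr => vw _; rewrite !flat_cons subnn andbA.
rewrite {}E0 {}E1.
have E2 : \sum_(0 <= i < n) \sum_(vw <- splits u') ((flat (i.+1 :: vw.1) == a)
      && (flat ((n.+1 - i.+1)%N :: vw.2) == b))%:R
    = if a is x :: a' then if b is y :: b' then
        (val x + val y == n.+1)%:R * N a' b' u' else 0 else 0 :> k.
  have sub i : (i < n)%N -> (n.+1 - i.+1 = (n - i.+1).+1)%N by lia.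
  case: a => [|x a].
    by rewrite big1 // => i _; rewrite big1 // => vw _; rewrite flat_cons.
  case: b => [|y b].
    rewrite big_nat big1 // => i /andP[_ lt]; rewrite big1 // => vw _.
    by rewrite sub // !flat_cons andbF.
  transitivity (\sum_(0 <= i < n)
      ((val x == i.+1) && (val y == (n - i.+1).+1))%:R * N a b u').
    apply: eq_big_nat => i /andP[_ lt]; rewrite /N -W.
    by apply: eq_bigr => vw _; rewrite sub // !flat_cons andbACA.
  rewrite -mulr_suml; congr (_ * _).
  move: (valP x) (valP y); move: (val x) (val y) => vx vy /= x0 y0.
  have [e|ne] := eqVneq (vx + vy)%N n.+1; last first.
    rewrite big_nat big1 // => i /andP[_ lt]; case: andP => // -[/eqP ex /eqP ey].
    by case/eqP: ne; lia.
  have xin : vx.-1 \in index_iota 0 n by rewrite mem_index_iota /=; lia.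
  rewrite (bigD1_seq _ xin (iota_uniq _ _)) /= prednK // eqxx big1 ?addr0.
    by have -> : vy == (n - vx).+1 by apply/eqP; lia.
  by move=> i ne; case: eqP => // ex; case/eqP: ne; rewrite ex.
rewrite {}E2 /=.
case: a b => [|x a] [|y b].
- by rewrite /quasi_shuffle stuffle0s big_seq1 flatS !addr0.
- rewrite /quasi_shuffle stuffle0s big_seq1 flatS eqseq_cons -val_eqE !addr0.
  rewrite -IH /quasi_shuffle stuffle0s big_seq1 -natrM mulnb //.
- rewrite /quasi_shuffle stuffles0 big_seq1 flatS eqseq_cons -val_eqE !add0r.
  rewrite -IH /quasi_shuffle stuffles0 big_seq1 -natrM mulnb //.
have Q (z : part) s : \sum_(c <- s) (z :: c == flat (n.+1 :: u'))%:R
    = (val z == n.+1)%:R * \sum_(c <- s) (c == flat u')%:R :> k.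
  rewrite big_distrr; apply: eq_bigr => c _ /=.
  by rewrite flatS eqseq_cons -val_eqE -natrM mulnb.
rewrite sum_stuffle_cons big_seq1 !Q !IH /= addrAC addrC addrA.
by rewrite [LHS]addrAC -addrA addrA.
Qed.

Definition is_character (k : comNzRingType) (A : algType k) (chi : A -> k) :
  Prop := scalar chi /\ monoid_morphism chi.

Definition is_inf_character (k : comNzRingType) (xi : qsym k -> k) : Prop :=
  scalar xi /\
  forall p q, xi (p * q) = counit p * xi q + xi p * counit q.

Definition f_Sh (k : comNzRingType) (f : Comp -> k) : sh k -> k :=
  lift (fun a : Comp => (if a is [::] then 1 else f a) : k^o).

Definition g_QSym (k : comNzRingType) (g : Comp -> k) : qsym k -> k :=
  lift (fun a : Comp => (if a is [::] then 0 else g a) : k^o).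

Lemma f_Sh_linear (k : comNzRingType) (f : Comp -> k) : scalar (f_Sh f).
Proof. by move=> c p q; rewrite /f_Sh linearP. Qed.
Lemma f_ShE (k : comNzRingType) (f : Comp -> k) a :
  f_Sh f (shX k a) = if a is [::] then 1 else f a.
Proof. by rewrite /f_Sh liftU. Qed.
Lemma g_QSym_linear (k : comNzRingType) (g : Comp -> k) : scalar (g_QSym g).
Proof. by move=> c p q; rewrite /g_QSym linearP. Qed.
Lemma g_QSymE (k : comNzRingType) (g : Comp -> k) a :
  g_QSym g (qM k a) = if a is [::] then 0 else g a.
Proof. by rewrite /g_QSym liftU. Qed.

(* Main.v *)
(* Let [F_a] be the sum of [f(a, b) b] over the coarsenings [b] of [a]; both
   [X_a] (with [f], in the basis [M]) and [M_a] (with [g], in the basis [X])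
   have this form.  Splitting off the first letter of [b] gives
     F_a = sum over a = uv of f(u) (|u| . F_v),
   where [|u| .] prepends the letter [|u|].  Deconcatenation is multiplicative
   for every (quasi-)shuffle product, so by induction on lengths [F] is
   multiplicative from one such product to another if and only if, for nonempty
   [a] and [b], the sum of [f] over the products of [a] and [b] is [f a * f b]
   (target: quasi-shuffle) or [0] (target: shuffle).  From [Sh] to [QSym] this
   says that [f^Sh] is a character; for the inverse map, from [QSym] to [Sh], it
   says that [g^QSym] is an infinitesimal character. *)
From HB Require Import structures.
Require Import Defs.
From mathcomp Require Import all_boot all_algebra.
From mathcomp Require Import finmap monalg zify.

Import GRing.Theory.
Local Open Scope ring_scope.

Set Implicit Arguments.
Unset Strict Implicit.
Unset Printing Implicit Defensive.

(** * Deconcatenation of words and its compatibility with stuffles *)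

Section Deconcatenation.
Variable T : Type.

(** Recursion on the word, rather than indexing by positions, makes the cut with empty prefix split
    off by computation. *)
Fixpoint deconc (a : seq T) : seq (seq T * seq T) :=
  if a is x :: a' then
    ([::], a) :: [seq (x :: p.1, p.2) | p <- deconc a']
  else [:: ([::], [::])].

Lemma sum_deconc_cons (V : nmodType) (h : seq T -> seq T -> V) x a :
  \sum_(p <- deconc (x :: a)) h p.1 p.2 =
  h [::] (x :: a) + \sum_(p <- deconc a) h (x :: p.1) p.2.
Proof. by rewrite /= big_cons big_map. Qed.

(** Multiplicativity of deconcatenation for any [m], tested against an arbitrary [h]. A cut stuffle
    either has empty prefix, or its prefix starts with [x], [y] or a merger of them. The latter
    cases follow by induction, with [h] absorbing that letter. *)
Lemma sum_deconc_stuffle (V : nmodType) (m : T -> T -> seq T)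
    (h : seq T -> seq T -> V) a b :
  \sum_(c <- stuffle m a b) \sum_(p <- deconc c) h p.1 p.2 =
  \sum_(p <- deconc a) \sum_(q <- deconc b)
    \sum_(d <- stuffle m p.1 q.1) \sum_(e <- stuffle m p.2 q.2) h d e.
Proof.
elim: a b h => [|x a IHa] b h.
  rewrite stuffle0s !big_seq1; apply: eq_bigr => q _.
  by rewrite !stuffle0s !big_seq1.
elim: b h => [|y b IHb] h.
  rewrite stuffles0 big_seq1; apply: eq_bigr => p _.
  by rewrite /= big_seq1 !stuffles0 !big_seq1.
rewrite sum_stuffle_cons.
under eq_bigr do rewrite sum_deconc_cons.
under [X in _ + X + _]eq_bigr do rewrite sum_deconc_cons.
under [X in _ + _ + X]eq_bigr do
  (under eq_bigr do rewrite sum_deconc_cons; rewrite big_split /=).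
rewrite !big_split /=.
rewrite (IHa _ (fun u => h (x :: u))) (IHb (fun u => h (y :: u))).
under [X in _ + (_ + X) = _]eq_bigr => z _ do rewrite (IHa b (fun u => h (z :: u))).
rewrite [RHS](sum_deconc_cons (fun u v => \sum_(q <- deconc (y :: b))
  \sum_(d <- stuffle m u q.1) \sum_(e <- stuffle m v q.2) h d e)).
rewrite (sum_deconc_cons (fun u v =>
  \sum_(d <- stuffle m [::] u) \sum_(e <- stuffle m (x :: a) v) h d e)).
rewrite (sum_deconc_cons (fun u v => \sum_(q <- deconc b)
  \sum_(d <- stuffle m u q.1) \sum_(e <- stuffle m v q.2) h (y :: d) e)).
rewrite stuffle0s big_seq1 sum_stuffle_cons /=.
(* [E1] and [E2] separate the cut of [y :: b] with empty prefix, in the terms starting with [x] and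
   on the right-hand side. [E2] also expands by first letter the stuffles of two nonempty
   prefixes. *)
have E1 p : \sum_(q <- deconc (y :: b)) \sum_(d <- stuffle m p.1 q.1)
      \sum_(e <- stuffle m p.2 q.2) h (x :: d) e =
    \sum_(e <- stuffle m p.2 (y :: b)) h (x :: p.1) e +
    \sum_(q <- deconc b) \sum_(d <- stuffle m p.1 (y :: q.1))
      \sum_(e <- stuffle m p.2 q.2) h (x :: d) e.
  rewrite (sum_deconc_cons (fun u v => \sum_(d <- stuffle m p.1 u)
    \sum_(e <- stuffle m p.2 v) h (x :: d) e)).
  by rewrite stuffles0 big_seq1.
have E2 p : \sum_(q <- deconc (y :: b)) \sum_(d <- stuffle m (x :: p.1) q.1)
      \sum_(e <- stuffle m p.2 q.2) h d e =
    \sum_(e <- stuffle m p.2 (y :: b)) h (x :: p.1) e +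
    (\sum_(q <- deconc b) \sum_(d <- stuffle m p.1 (y :: q.1))
      \sum_(e <- stuffle m p.2 q.2) h (x :: d) e +
    \sum_(q <- deconc b) \sum_(d <- stuffle m (x :: p.1) q.1)
      \sum_(e <- stuffle m p.2 q.2) h (y :: d) e +
    \sum_(q <- deconc b) \sum_(z <- m x y) \sum_(d <- stuffle m p.1 q.1)
      \sum_(e <- stuffle m p.2 q.2) h (z :: d) e).
  rewrite (sum_deconc_cons (fun u v => \sum_(d <- stuffle m (x :: p.1) u)
    \sum_(e <- stuffle m p.2 v) h d e)).
  rewrite stuffles0 big_seq1 -!big_split; congr (_ + _).
  by apply: eq_bigr => q _; rewrite sum_stuffle_cons.
have E3 : \sum_(z <- m x y) \sum_(p <- deconc a) \sum_(q <- deconc b)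
      \sum_(d <- stuffle m p.1 q.1) \sum_(e <- stuffle m p.2 q.2) h (z :: d) e =
    \sum_(p <- deconc a) \sum_(q <- deconc b) \sum_(z <- m x y)
      \sum_(d <- stuffle m p.1 q.1) \sum_(e <- stuffle m p.2 q.2) h (z :: d) e.
  by rewrite exchange_big; apply: eq_bigr => p _; rewrite exchange_big.
rewrite E3 (eq_bigr _ (fun p _ => E1 p)) (eq_bigr _ (fun p _ => E2 p)).
rewrite !big_split /=.
under [X in _ + (_ + (X + _)) + _ = _]eq_bigr do rewrite stuffle0s big_seq1.
under [X in _ = _ + X + _]eq_bigr do rewrite stuffle0s big_seq1.
have ac (A1 B2 B3 A4 B5 B6 A7 B8 : V) :
    A1 + (B2 + B3) + (A4 + (B5 + B6)) + (A7 + B8) =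
    A1 + A4 + A7 + B5 + (B2 + (B3 + B6 + B8)).
  by rewrite !addrA [LHS](ACl (1*4*7*5*2*3*6*8)).
exact: ac.
Qed.
End Deconcatenation.

(** * Cuts of a composition and weights of prefixes *)

Lemma mem_deconc (T : eqType) (a : seq T) p : p \in deconc a -> p.1 ++ p.2 = a.
Proof.
elim: a p => [|x a IH] p /=; first by rewrite inE => /eqP->.
by rewrite inE => /orP[/eqP->|/mapP[q /IH <- ->]].
Qed.

Lemma cat_take_drop_wt n (a : Comp) : take_wt n a ++ drop_wt n a = a.
Proof.
by elim: a n => //= x a IH n; case: ifP => //= _; rewrite IH.
Qed.

Lemma comp_le_cons (n : part) (a b : Comp) :
  comp_le a (n :: b) =
  (wt (take_wt (val n) a) == val n) && comp_le (drop_wt (val n) a) b.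
Proof.
rewrite /comp_le /= -{1}(cat_take_drop_wt (val n) a) eqseq_cat // eqxx /=.
by rewrite eqseq_cons andbCA.
Qed.

(** Parts are positive, so prefix weights strictly increase and at most one cut has prefix weight
    [n]. If the prefix [take_wt n a] misses that weight, no cut attains it. *)
Lemma sum_deconc_wt (V : nmodType) (h : Comp -> Comp -> V) n (a : Comp) :
  \sum_(p <- deconc a | wt p.1 == n) h p.1 p.2 =
  if wt (take_wt n a) == n then h (take_wt n a) (drop_wt n a) else 0.
Proof.
elim: a n h => [|x a IH] n h; first by rewrite /= big_mkcond big_seq1.
rewrite /= big_cons big_map /=; have x0 := valP x.
have [->|n0] := eqVneq n 0%N.
  rewrite eqxx big1 ?addr0 // => p; rewrite wt_cons; lia.
rewrite wt_cons; have [lt|le] := ltnP n (val x).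
  rewrite big1; last by move=> p; rewrite wt_cons; lia.
  by case: eqP => //; lia.
have E w : (val x + w == n)%N = (w == n - val x)%N.
  by rewrite -(eqn_add2l (val x) w) subnKC.
under eq_bigl => p do rewrite wt_cons E.
by rewrite (IH _ (fun u v => h (x :: u) v)) E.
Qed.

Lemma wt_eq0 (a : Comp) : (wt a == 0%N) = (a == [::]).
Proof. by case: a => //= x a; rewrite wt_cons addn_eq0 (gtn_eqF (valP x)). Qed.

(** Serves the linearity checks of the three-term product formulas below. *)
Lemma add3ACA (V : nmodType) (p1 p2 q1 q2 r1 r2 : V) :
  p1 + p2 + (q1 + q2) + (r1 + r2) = p1 + q1 + r1 + (p2 + q2 + r2).
Proof. by rewrite [p1 + p2 + _]addrACA addrACA. Qed.

(** * Sums over coarsenings and their recursion on the first block *)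

Section Coarse.
Variable k : comNzRingType.
Implicit Type f : Comp -> k.

(** This is the [F_a] of the overview, in coordinates: [<< b >>] stands for [M_b] when the function
    is [f], and for [X_b] when it is [g]. *)
Definition coarse f (a : Comp) : {malg k[Comp]} :=
  \sum_(b <- coarsenings a) fpair f a b *: << b >>.

Lemma mcoeff_coarse f a b :
  (coarse f a)@_b = if comp_le a b then fpair f a b else 0.
Proof.
rewrite /coarse raddf_sum /= -mem_coarsenings.
under eq_bigr do rewrite mcoeffZ mcoeffU.
case: ifP => ab.
  rewrite (bigD1_seq b ab (uniq_coarsenings a)) /= eqxx mulr1 big1 ?addr0 //.
  by move=> c /negPf->; rewrite mulr0.
rewrite big_seq big1 // => c ca; case: eqP => [e|_]; last by rewrite mulr0.
by rewrite -e ca in ab.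
Qed.

(* Zero when [n = 0], so that no nonemptiness condition on the prefix [p.1]
   is needed in [coarse_deconc]. *)
Definition prepend (n : nat) : {malg k[Comp]} -> {malg k[Comp]} :=
  Defs.lift (fun a => if insub n is Some i then << (i : part) :: a >> else 0).
HB.instance Definition _ n := GRing.Linear.on (prepend n).

Lemma prepend0 (p : {malg k[Comp]}) : prepend 0 p = 0.
Proof.
move: p; apply: lin_ext_prop => [c x y|c x y|a]; rewrite ?linearP //.
  by rewrite scaler0 addr0.
by rewrite /prepend liftU insubF.
Qed.

Lemma prepend_sum n I (r : seq I) (F : I -> {malg k[Comp]}) :
  prepend n (\sum_(i <- r) F i) = \sum_(i <- r) prepend n (F i).
Proof. exact: linear_sum. Qed.

Lemma prepend_val (i : part) a : prepend (val i) << a >> = << i :: a >>.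
Proof. by rewrite /prepend liftU valK. Qed.

Lemma mcoeff_prepend0 n p : (prepend n p)@_[::] = 0.
Proof.
move: p; apply: scalar_ext => [c x y|c x y|a].
- by rewrite linearP mcoeffD mcoeffZ.
- by rewrite mulr0 addr0.
by rewrite /prepend liftU; case: insubP => [i _ _|_]; rewrite (mcoeffU, mcoeff0).
Qed.

Lemma mcoeff_prepend n p i b :
  (prepend n p)@_(i :: b) = if n == val i then p@_b else 0.
Proof.
move: p; apply: scalar_ext => [c x y|c x y|a].
- by rewrite linearP mcoeffD mcoeffZ.
- by rewrite mcoeffD mcoeffZ; case: eqP; rewrite // mulr0 addr0.
rewrite /prepend liftU; case: insubP => [j _ <-|n0].
  rewrite !mcoeffU eqseq_cons val_eqE; case: eqP => //.
by rewrite mcoeff0; case: eqP => // e; rewrite e (valP i) in n0.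
Qed.

Lemma coarse_nil f : coarse f [::] = << [::] >>.
Proof. by rewrite /coarse /= big_seq1 /fpair big_nil scale1r. Qed.

(** Coarsenings of [a] are sorted by their first letter: it is the weight of the first block [p.1],
    and the remaining letters coarsen [p.2]. Both sides are compared coefficient by coefficient. *)
Lemma coarse_deconc f a : a != [::] ->
  coarse f a = \sum_(p <- deconc a) f p.1 *: prepend (wt p.1) (coarse f p.2).
Proof.
move=> a0; apply/malgP => -[|n b]; rewrite mcoeff_coarse raddf_sum /=.
  rewrite big1; last by move=> p _; rewrite mcoeffZ mcoeff_prepend0 mulr0.
  by rewrite /comp_le /= (negPf a0).
rewrite comp_le_cons /fpair /= big_cons.
under [RHS]eq_bigr do rewrite mcoeffZ mcoeff_prepend mcoeff_coarse.
have -> : \sum_(p <- deconc a) f p.1 * (if wt p.1 == val n then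
      (if comp_le p.2 b then fpair f p.2 b else 0) else 0) =
    \sum_(p <- deconc a | wt p.1 == val n) f p.1 *
      (if comp_le p.2 b then fpair f p.2 b else 0).
  rewrite [RHS]big_mkcond; apply: eq_bigr => p _.
  by case: ifP => // _; rewrite mulr0.
(* The only cut that can contribute is the one whose prefix is the first block, of weight
   [val n]. *)
rewrite (sum_deconc_wt (fun u v => f u * (if comp_le v b then fpair f v b else 0))).
by case: (wt _ == _) => //=; case: (comp_le _ _) => //; rewrite mulr0.
Qed.

Lemma coarse0 f a : (coarse f a)@_[::] = (a == [::])%:R.
Proof.
have [->|a0] := eqVneq a [::]; first by rewrite coarse_nil mcoeffUU.
rewrite coarse_deconc // raddf_sum big1 //= => p _.
by rewrite mcoeffZ mcoeff_prepend0 mulr0.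
Qed.

(** * Weights and lengths of the terms of the two products *)

(* [merge true] gives the product of [qsym], [merge false] that of [sh]. *)
Definition merge (e : bool) (i j : part) : seq part :=
  if e then [:: part_add i j] else [::].

Lemma wt_stuffle e a b c : c \in stuffle (merge e) a b -> wt c = (wt a + wt b)%N.
Proof.
elim: a b c => [|x a IHa] b c; first by rewrite stuffle0s inE => /eqP->.
elim: b c => [|y b IHb] c; first by rewrite stuffles0 inE addn0 => /eqP->.
rewrite stuffle_cons !mem_cat => /or3P[/mapP[d /IHa + ->]|/mapP[d /IHb + ->]|].
- by rewrite !wt_cons => ->; rewrite !addnA.
- by rewrite !wt_cons => ->; rewrite addnCA.
case: e IHa {IHb} => IHa //=; rewrite cats0 => /mapP[d /IHa + ->].
by rewrite !wt_cons => ->; rewrite addnACA.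
Qed.

Lemma sum_stuffle_size0 e a b :
  \sum_(c <- stuffle (merge e) a b) (c == [::])%:R =
  (a == [::])%:R * (b == [::])%:R :> k.
Proof.
case: a => [|x a]; first by rewrite stuffle0s big_seq1 mul1r.
case: b => [|y b]; first by rewrite stuffles0 big_seq1 mulr1.
rewrite sum_stuffle_cons !big1 ?addr0 ?mul0r // => ? _.
by rewrite big1.
Qed.

(** The value of [linear_part] on a product of basis elements; the last term is the merger of two
    single letters. *)
Lemma sum_stuffle_size1 e a b :
  \sum_(c <- stuffle (merge e) a b) (size c == 1)%:R =
  (a == [::])%:R * (size b == 1)%:R + (size a == 1)%:R * (b == [::])%:R
  + e%:R * ((size a == 1)%:R * (size b == 1)%:R) :> k.
Proof.
case: a => [|x a].
  by rewrite stuffle0s big_seq1 mul1r !mul0r mulr0 !addr0.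
case: b => [|y b].
  by rewrite stuffles0 big_seq1 mulr1 mul0r !mulr0 add0r addr0.
have E (s t : Comp) : \sum_(c <- stuffle (merge e) s t) (size c == 0%N)%:R =
    (size s == 0%N)%:R * (size t == 0%N)%:R :> k.
  rewrite !size_eq0 -(sum_stuffle_size0 e).
  by apply: eq_bigr => c _; rewrite size_eq0.
rewrite sum_stuffle_cons /= !eqSS !E /= !mulr0 !mul0r !add0r.
by case: e {E}; rewrite /merge ?big_seq1 ?big_nil ?mul1r ?mul0r.
Qed.

Lemma sum_deconc_nil (h : Comp -> k) a :
  \sum_(p <- deconc a) h p.1 * (p.2 == [::])%:R = h a.
Proof.
elim: a h => [|x a IH] h; first by rewrite /= big_seq1 eqxx mulr1.
rewrite (sum_deconc_cons (fun u v => h u * (v == [::])%:R)) mulr0 add0r.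
exact: (IH (fun u => h (x :: u))).
Qed.

(** The functional that recovers [f] from [coarse f]. On [qsym], its sum with the counit is
    evaluation at [x_1 = 1] and all other variables [0]. *)
Definition linear_part (p : {malg k[Comp]}) : k :=
  Defs.lift (fun a => (size a == 1)%:R : k^o) p.

Lemma linear_part_is_scalar : scalar linear_part.
Proof. by move=> c p q; rewrite /linear_part linearP. Qed.
HB.instance Definition _ :=
  GRing.isLinear.Build k {malg k[Comp]} k *%R linear_part linear_part_is_scalar.

Lemma linear_part_prepend n p : linear_part (prepend n p) = (n != 0)%:R * p@_[::].
Proof.
move: p; apply: scalar_ext => [c x y|c x y|a].
- by rewrite !linearP.
- by rewrite mcoeffD mcoeffZ mulrDr mulrCA.
rewrite /prepend liftU; case: insubP => [i i0 _|].
  by rewrite /linear_part liftU mcoeffU /= eqSS size_eq0 -lt0n i0 mul1r.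
by rewrite -eqn0Ngt => /eqP->; rewrite linear0 mul0r.
Qed.

(** The only one-letter coarsening of [a] merges everything into one block, with coefficient [f a];
    in the recursion it is the cut with empty suffix. *)
Lemma linear_part_coarse f a : a != [::] -> linear_part (coarse f a) = f a.
Proof.
move=> a0; rewrite coarse_deconc // linear_sum /=.
have E p : linear_part (f p.1 *: prepend (wt p.1) (coarse f p.2)) =
    (f p.1 * (p.1 != [::])%:R) * (p.2 == [::])%:R.
  by rewrite linearZ /= linear_part_prepend coarse0 wt_eq0 mulrA.
rewrite (eq_bigr _ (fun p _ => E p)).
by rewrite (sum_deconc_nil (fun u => f u * (u != [::])%:R)) a0 mulr1.
Qed.

(** * The shuffle and quasi-shuffle products, treated together *)

Section StuffleMul.
Variable e : bool.
Local Notation "p ** q" := (stuffle_mul (merge e) p q) (at level 40).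
Implicit Types p q : {malg k[Comp]}.

Lemma mergeC i j : merge e i j = merge e j i.
Proof. by rewrite /merge part_addC. Qed.

Lemma stuffle_mulr1 p : p ** << [::] >> = p.
Proof. by rewrite (stuffle_mulC mergeC) stuffle_mul1. Qed.

Lemma stuffle_mul_suml I (r : seq I) (c : I -> k) (F : I -> {malg k[Comp]}) q :
  (\sum_(i <- r) c i *: F i) ** q = \sum_(i <- r) c i *: (F i ** q).
Proof.
by rewrite /stuffle_mul linear_sum; apply: eq_bigr => i _; rewrite linearZ.
Qed.

Lemma stuffle_mul_sumr I (r : seq I) (c : I -> k) (F : I -> {malg k[Comp]}) p :
  p ** (\sum_(i <- r) c i *: F i) = \sum_(i <- r) c i *: (p ** F i).
Proof.
rewrite (stuffle_mulC mergeC) stuffle_mul_suml.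
by apply: eq_bigr => i _; rewrite (stuffle_mulC mergeC).
Qed.

(** For [e] true this says that counit plus [linear_part] is a character; for [e] false, that
    [linear_part] is an infinitesimal character. *)
Lemma linear_part_mul p q :
  linear_part (p ** q) = p@_[::] * linear_part q + linear_part p * q@_[::]
    + e%:R * (linear_part p * linear_part q).
Proof.
move: p; apply: scalar_ext => [c x y|c x y|a].
- by rewrite stuffle_mulPl linearP.
- rewrite mcoeffD mcoeffZ linearP /= !mulrDl !mulrDr -!mulrA [e%:R * (c * _)]mulrCA.
  exact: add3ACA.
move: q; apply: scalar_ext => [c x y|c x y|b].
- by rewrite stuffle_mulPr linearP.
- rewrite mcoeffD mcoeffZ linearP /= !mulrDr ![_ * (c * _)]mulrCA.
  exact: add3ACA.
rewrite stuffle_mulUU linear_sum !mcoeffU /= /linear_part !liftU.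
by under eq_bigr do rewrite liftU; exact: sum_stuffle_size1.
Qed.

(** The recursion of the product on first letters, extended bilinearly. Positivity matters: at
    [i = 0] the left side vanishes, while for [e] true the last term need not. *)
Lemma stuffle_mul_prepend i j p q : (0 < i)%N -> (0 < j)%N ->
  prepend i p ** prepend j q =
  prepend i (p ** prepend j q) + prepend j (prepend i p ** q)
  + e%:R *: prepend (i + j) (p ** q).
Proof.
move=> i0 j0; rewrite -[i]/(val (Sub i i0 : part)) -[j]/(val (Sub j j0 : part)).
move: (Sub i i0) (Sub j j0) => {i0 j0} {}i {}j.
move: p; apply: lin_ext_prop => [c x y|c x y|a].
- by rewrite linearP stuffle_mulPl.
- rewrite !(stuffle_mulPl, linearP) /= !scalerDr.
  exact: add3ACA.
move: q; apply: lin_ext_prop => [c x y|c x y|b].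
- by rewrite linearP stuffle_mulPr.
- rewrite !(stuffle_mulPr, linearP) /= !scalerDr.
  exact: add3ACA.
rewrite !prepend_val !stuffle_mulUU sum_stuffle_cons !prepend_sum.
apply: f_equal2; first apply: f_equal2.
- by apply: eq_bigr => c _; rewrite prepend_val.
- by apply: eq_bigr => c _; rewrite prepend_val.
rewrite /merge; case: e; last by rewrite big_nil mulr0n scale0r.
rewrite big_seq1 mulr1n scale1r; apply: eq_bigr => c _.
by rewrite -prepend_val.
Qed.
End StuffleMul.

(** * The multiplicativity criterion *)

(** Here [e] selects the source product and [e'] the target. Forward, [linear_part] turns the
    product identity into the scalar one; backward, both sides are expanded by first blocks, with
    induction on the total length. *)
Lemma coarse_mulP (e e' : bool) f :
  (forall a b, stuffle_mul (merge e') (coarse f a) (coarse f b) =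
     \sum_(c <- stuffle (merge e) a b) coarse f c) <->
  (forall a b, a != [::] -> b != [::] ->
     \sum_(c <- stuffle (merge e) a b) f c = e'%:R * (f a * f b)).
Proof.
have stuffle_neq0 a b c : a != [::] -> c \in stuffle (merge e) a b -> c != [::].
  by rewrite -!wt_eq0 => a0 /wt_stuffle->; rewrite addn_eq0 (negPf a0).
split=> [mul a b a0 b0|char a b].
  transitivity (linear_part (\sum_(c <- stuffle (merge e) a b) coarse f c)).
    rewrite linear_sum /= big_seq [RHS]big_seq; apply: eq_bigr => c /stuffle_neq0.
    by move=> c0; rewrite linear_part_coarse ?c0.
  rewrite -mul linear_part_mul !coarse0 (negPf a0) (negPf b0) mul0r mulr0 !add0r.
  by rewrite !linear_part_coarse.
have [n] := ubnP (size a + size b); elim: n a b => // n IH [|x a] [|y b] lt.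
- by rewrite coarse_nil stuffle_mul1 stuffle0s big_seq1 coarse_nil.
- by rewrite coarse_nil stuffle_mul1 stuffle0s big_seq1.
- by rewrite coarse_nil stuffle_mulr1 stuffles0 big_seq1.
(* The first block always contains [z], because [prepend 0] kills the cut with empty prefix. *)
have Fc z c : coarse f (z :: c) = \sum_(p <- deconc c)
    f (z :: p.1) *: prepend (wt (z :: p.1)) (coarse f p.2).
  rewrite (@coarse_deconc f (z :: c) isT).
  rewrite (sum_deconc_cons (fun u v => f u *: prepend (wt u) (coarse f v))).
  by rewrite prepend0 scaler0 add0r.
set M := stuffle_mul (merge e').
(* The first letter of the target product comes from the first block of [x :: a], from that of
   [y :: b], or from both merged. *)
transitivity (
  \sum_(p <- deconc a) f (x :: p.1) *:
    prepend (wt (x :: p.1)) (M (coarse f p.2) (coarse f (y :: b))) +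
  \sum_(q <- deconc b) f (y :: q.1) *:
    prepend (wt (y :: q.1)) (M (coarse f (x :: a)) (coarse f q.2)) +
  \sum_(p <- deconc a) \sum_(q <- deconc b)
    (e'%:R * (f (x :: p.1) * f (y :: q.1))) *:
    prepend (wt (x :: p.1) + wt (y :: q.1)) (M (coarse f p.2) (coarse f q.2))).
  have wt0 z c : (0 < wt (z :: c))%N by rewrite lt0n wt_eq0.
  transitivity (\sum_(p <- deconc a) \sum_(q <- deconc b)
      (f (x :: p.1) * f (y :: q.1)) *: M (prepend (wt (x :: p.1)) (coarse f p.2))
        (prepend (wt (y :: q.1)) (coarse f q.2))).
    rewrite {1}Fc {1}Fc /M stuffle_mul_suml; apply: eq_bigr => p _.
    rewrite stuffle_mul_sumr scaler_sumr; apply: eq_bigr => q _.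
    by rewrite scalerA.
  under eq_bigr do (under eq_bigr do
    rewrite /M (stuffle_mul_prepend _ _ _ (wt0 _ _) (wt0 _ _)) !scalerDr scalerA;
    rewrite !big_split).
  rewrite !big_split /=; apply: f_equal2; first apply: f_equal2.
  - apply: eq_bigr => p _; rewrite Fc /M stuffle_mul_sumr prepend_sum scaler_sumr.
    by apply: eq_bigr => q _; rewrite linearZ scalerA.
  - rewrite exchange_big; apply: eq_bigr => q _.
    rewrite Fc /M stuffle_mul_suml prepend_sum scaler_sumr.
    by apply: eq_bigr => p _; rewrite linearZ scalerA mulrC.
  - by do 2!apply: eq_bigr => ? _; rewrite mulrC.
pose H u v := f u *: prepend (wt u) (coarse f v).
(* On the source side each [coarse f c] is cut after its first block; cutting a stuffle then amounts
   to stuffling the cuts. *)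
transitivity (\sum_(c <- stuffle (merge e) (x :: a) (y :: b))
    \sum_(p <- deconc c) H p.1 p.2); last first.
  rewrite big_seq [RHS]big_seq; apply: eq_bigr => c /stuffle_neq0 c0.
  by rewrite coarse_deconc ?c0.
have SH u v w : \sum_(d <- stuffle (merge e) u v) H w d =
    f w *: prepend (wt w) (\sum_(d <- stuffle (merge e) u v) coarse f d).
  by rewrite /H -scaler_sumr prepend_sum.
rewrite sum_deconc_stuffle.
rewrite (sum_deconc_cons (fun u v => \sum_(q <- deconc (y :: b))
  \sum_(d <- stuffle (merge e) u q.1) \sum_(c <- stuffle (merge e) v q.2) H d c)).
rewrite (sum_deconc_cons (fun u v => \sum_(d <- stuffle (merge e) [::] u)
  \sum_(c <- stuffle (merge e) (x :: a) v) H d c)).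
(* Two empty prefixes give first block of weight [0], hence nothing. *)
rewrite stuffle0s big_seq1 SH prepend0 scaler0 add0r.
have E p : \sum_(q <- deconc (y :: b))
      \sum_(d <- stuffle (merge e) (x :: p.1) q.1)
      \sum_(c <- stuffle (merge e) p.2 q.2) H d c =
    \sum_(c <- stuffle (merge e) p.2 (y :: b)) H (x :: p.1) c +
    \sum_(q <- deconc b) \sum_(d <- stuffle (merge e) (x :: p.1) (y :: q.1))
      \sum_(c <- stuffle (merge e) p.2 q.2) H d c.
  rewrite (sum_deconc_cons (fun u v => \sum_(d <- stuffle (merge e) (x :: p.1) u)
    \sum_(c <- stuffle (merge e) p.2 v) H d c)).
  by rewrite stuffles0 big_seq1.
rewrite (eq_bigr _ (fun p _ => E p)) big_split /= addrCA addrA.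
have le (T : eqType) (c : seq T) p : p \in deconc c -> (size p.2 <= size c)%N.
  by move=> /mem_deconc <-; rewrite size_cat leq_addl.
have lta : (size a + (size b).+1 < n)%N := lt.
have ltb : ((size a).+1 + size b < n)%N by rewrite addSnnS.
(* The three groups are the pairs of cuts where only the prefix from [x :: a], only that from
   [y :: b], or both are nonempty. *)
apply: f_equal2; first apply: f_equal2.
- rewrite big_seq [RHS]big_seq; apply: eq_bigr => p /le pa.
  by rewrite SH -IH //; exact: leq_ltn_trans (leq_add pa (leqnn _)) lta.
- rewrite big_seq [RHS]big_seq; apply: eq_bigr => q /le qb.
  rewrite stuffle0s big_seq1 SH -IH //.
  exact: leq_ltn_trans (leq_add (leqnn _) qb) ltb.
rewrite big_seq [RHS]big_seq; apply: eq_bigr => p /le pa.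
rewrite big_seq [RHS]big_seq; apply: eq_bigr => q /le qb.
(* The scalar hypothesis is applied to the two nonempty prefixes; all their stuffles have the same
   weight, so [prepend] acts alike on each. *)
rewrite -char // scaler_suml big_seq [RHS]big_seq.
apply: eq_bigr => d /wt_stuffle wd.
by rewrite SH wd /M IH //; exact: leq_ltn_trans (leq_add pa qb) (ltnW ltb).
Qed.
End Coarse.

(** * Multiplicative linear maps and their inverses *)

Lemma stuffle_mul_ext (k : comNzRingType) (m m' : part -> part -> seq part)
    (F : Comp -> {malg k[Comp]}) :
  (forall a b, stuffle_mul m' (F a) (F b) = \sum_(c <- stuffle m a b) F c) ->
  forall p q, Defs.lift F (stuffle_mul m p q) =
    stuffle_mul m' (Defs.lift F p) (Defs.lift F q).
Proof.
move=> mul p q; move: p; apply: lin_ext_prop => [c x y|c x y|a].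
- by rewrite stuffle_mulPl linearP.
- by rewrite linearP stuffle_mulPl.
move: q; apply: lin_ext_prop => [c x y|c x y|b].
- by rewrite stuffle_mulPr linearP.
- by rewrite linearP stuffle_mulPr.
rewrite stuffle_mulUU !liftU mul linear_sum.
by apply: eq_bigr => c _; exact: liftU.
Qed.

(** The inverse of a bijective multiplicative map is multiplicative; the identity is checked after
    applying the injective [lift F]. *)
Lemma stuffle_mul_can (k : comNzRingType) (m m' : part -> part -> seq part)
    (F G : Comp -> {malg k[Comp]}) :
  cancel (Defs.lift F) (Defs.lift G) -> cancel (Defs.lift G) (Defs.lift F) ->
  (forall a b, stuffle_mul m' (F a) (F b) = \sum_(c <- stuffle m a b) F c) ->
  forall a b, stuffle_mul m (G a) (G b) = \sum_(c <- stuffle m' a b) G c.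
Proof.
move=> FK GK /stuffle_mul_ext mul a b; apply: (can_inj FK).
rewrite mul -!(liftU G) !GK stuffle_mulUU.
transitivity (Defs.lift F (Defs.lift G (\sum_(c <- stuffle m' a b) << c >>))).
  by rewrite GK.
congr (Defs.lift F _); rewrite linear_sum.
by apply: eq_bigr => c _; exact: liftU.
Qed.

Lemma lift_stuffle_mul (k : comNzRingType) (m : part -> part -> seq part)
    (h : Comp -> k^o) a b :
  Defs.lift h (stuffle_mul m << a >> << b >>) = \sum_(c <- stuffle m a b) h c.
Proof.
by rewrite stuffle_mulUU linear_sum; apply: eq_bigr => c _; exact: liftU.
Qed.

(** * Characters and infinitesimal characters as scalar identities *)

(** Pairs with an empty member are settled by the unit. Otherwise every shuffle is nonempty, and
    [f_Sh] takes its values from [f]. The factor [true%:R] matches [coarse_mulP] with quasi-shuffle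
    target. *)
Lemma f_Sh_characterP (k : comNzRingType) (f : Comp -> k) :
  is_character (f_Sh f) <->
  (forall a b, a != [::] -> b != [::] ->
     \sum_(c <- stuffle (merge false) a b) f c = true%:R * (f a * f b)).
Proof.
have lin := f_Sh_linear f.
have fE a : a != [::] -> f_Sh f (shX k a) = f a.
  by case: a => // x a _; exact: f_ShE.
have sumE a b : a != [::] -> f_Sh f (shX k a * shX k b) =
    \sum_(c <- stuffle (merge false) a b) f c.
  move=> a0; apply: etrans (lift_stuffle_mul _ _ _ _) _.
  rewrite big_seq [RHS]big_seq; apply: eq_bigr => -[|//] /(@wt_stuffle false) /esym/eqP.
  by rewrite addn_eq0 wt_eq0 (negPf a0).
split=> [[_ [_ mul]] a b a0 b0|char].
  by rewrite -sumE // mul !fE // mul1r.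
split=> //; split; first exact: f_ShE.
move=> p q; move: p; apply: scalar_ext => [c x y|c x y|a].
- by rewrite mulrDl -scalerAl lin.
- by rewrite lin mulrDl mulrA.
move: q; apply: scalar_ext => [c x y|c x y|b].
- by rewrite mulrDr -scalerAr lin.
- by rewrite lin mulrDr mulrCA.
rewrite -!/(shX k _).
have [->|a0] := eqVneq a [::]; first by rewrite f_ShE mul1r [_ * _]mul1r.
have [->|b0] := eqVneq b [::].
  by rewrite [_ * shX k _]mulr1 [f_Sh f (shX k [::])]f_ShE mulr1.
by rewrite sumE // char // !fE // mul1r.
Qed.

(** On two nonempty compositions both counits vanish, so the sum must be zero; writing it with
    [false%:R] matches [coarse_mulP] with shuffle target. *)
Lemma g_QSym_inf_characterP (k : comNzRingType) (g : Comp -> k) :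
  is_inf_character (g_QSym g) <->
  (forall a b, a != [::] -> b != [::] ->
     \sum_(c <- stuffle (merge true) a b) g c = false%:R * (g a * g b)).
Proof.
have lin := g_QSym_linear g.
have sumE a b : a != [::] -> g_QSym g (qM k a * qM k b) =
    \sum_(c <- stuffle (merge true) a b) g c.
  move=> a0; apply: etrans (lift_stuffle_mul _ _ _ _) _.
  rewrite big_seq [RHS]big_seq; apply: eq_bigr => -[|//] /(@wt_stuffle true) /esym/eqP.
  by rewrite addn_eq0 wt_eq0 (negPf a0).
have counitE a : counit (qM k a) = (a == [::])%:R by rewrite /counit mcoeffU.
split=> [[_ mul] a b a0 b0|char].
  by rewrite -sumE // mul !counitE (negPf a0) (negPf b0) mulr0 !mul0r addr0.
have counitP c x y : counit (c *: x + y) = c * counit x + counit y :> k.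
  by rewrite /counit mcoeffD mcoeffZ.
split=> // p q; move: p; apply: scalar_ext => [c x y|c x y|a].
- by rewrite mulrDl -scalerAl lin.
- by rewrite lin counitP !mulrDl mulrDr !mulrA addrACA.
move: q; apply: scalar_ext => [c x y|c x y|b].
- by rewrite mulrDr -scalerAr lin.
- by rewrite lin counitP !mulrDr ![_ * (c * _)]mulrCA addrACA.
rewrite -!/(qM k _).
have c1 : counit (qM k [::]) = 1 by rewrite counitE.
have g1 : g_QSym g (qM k [::]) = 0 := g_QSymE g [::].
have [->|a0] := eqVneq a [::].
  by rewrite c1 g1 mul1r mul0r addr0; congr (g_QSym g _); exact: mul1r.
have [->|b0] := eqVneq b [::].
  by rewrite c1 g1 mulr1 mulr0 add0r; congr (g_QSym g _); exact: mulr1.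
rewrite !counitE (negPf a0) (negPf b0).
by rewrite sumE // char // !mul0r mulr0 addr0.
Qed.

(** * The equivalence of the three conditions *)

Theorem theorem4p5 (k : fieldType) (X : Comp -> qsym k) (f g : Comp -> k)
    (hX : deconcatenation_basis X)
    (hf : nonsingular f) (hg : nonsingular g)
    (hXM : forall a : Comp,
       X a = \sum_(b <- coarsenings a) fpair f a b *: qM k b)
    (hMX : forall a : Comp,
       qM k a = \sum_(b <- coarsenings a) fpair g a b *: X b) :
  (shuffle_basis X <-> is_character (f_Sh f)) /\
  (is_character (f_Sh f) <-> is_inf_character (g_QSym g)).
Proof.
have XE a : X a = coarse f a by exact: hXM.
(* Substituting the expansion of [X] into that of [qM k a] gives back [qM k a]. *)
have GX : cancel (Defs.lift (coarse g)) (Defs.lift (coarse f)).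
  apply: lin_ext_prop => [c x y|c x y|a]; rewrite ?linearP //.
  rewrite liftU /coarse linear_sum -[RHS]/(qM k a) hMX; apply: eq_bigr => b _.
  by rewrite linearZ /= liftU XE.
(* The other composite: coordinates in the basis [X] are unique, so [lift (coarse f)] is injective,
   and its right inverse is two-sided. *)
have XG : cancel (Defs.lift (coarse f)) (Defs.lift (coarse g)).
  have inj : injective (Defs.lift (coarse f)).
    move=> p q pq; have [B _ _] := hX.
    have [r [_ r_uniq]] := B (Defs.lift X p).
    have liftX u : Defs.lift X u = Defs.lift (coarse f) u.
      by apply: eq_bigr => a _; rewrite XE.
    by rewrite -(r_uniq p) // -(r_uniq q) // !liftX.
  by move=> p; apply: inj; rewrite GX.
have mulX : shuffle_basis X <-> is_character (f_Sh f).
  rewrite f_Sh_characterP -coarse_mulP; split=> [[_ mul] a b|mul].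
    rewrite -!XE; apply: etrans (mul a b) _; apply: eq_bigr => c _; exact: XE.
  split=> // a b; rewrite !XE; apply: etrans (mul a b) _.
  by apply: eq_bigr => c _; rewrite XE.
split=> //; rewrite f_Sh_characterP g_QSym_inf_characterP -!coarse_mulP.
(* The map from [sh] to [qsym] given by [f] is multiplicative exactly when its inverse, given by
   [g], is. *)
by split; [exact: (stuffle_mul_can XG GX) | exact: (stuffle_mul_can GX XG)].
Qed.
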